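(* For every integer $d\ge 12$, $\mathcal S_d\ne\mathcal P_d$.
   Context: All random variables and random vectors are defined on a fixed atomless probability space. For random variables $X_1,X_2$ with continuous distribution functions $F_1,F_2$, Spearman's rho is $\rho^S(X_1,X_2)=\rho^P(F_1(X_1),F_2(X_2))=12\,\mathbb E[F_1(X_1)F_2(X_2)]-3$, where $\rho^P$ is the Pearson (linear) correlation coefficient. For a $d$-dimensional random vector $X=(X_1,\dots,X_d)$ with continuous marginal distributions, its Spearman's rho matrix is the $d\times d$ matrix with entries $\rho^S(X_i,X_j)$, $i,j=1,\dots,d$. A $d\times d$ matrix is called a Spearman's rho matrix if it is the Spearman's rho matrix of some $d$-dimensional random vector with continuous marginal distributions. $\mathcal S_d$ denotes the set of all $d\times d$ Spearman's rho matrices. $\mathcal P_d$ denotes the set of all $d\times d$ real symmetric positive semi-definite matrices whose diagonal entries are all equal to $1$ (equivalently, the set of all $d\times d$ linear correlation matrices). *)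

(* Defs.v *)
From HB Require Import structures.
From mathcomp Require Import all_boot all_order all_algebra.
From mathcomp Require Import all_classical all_reals all_analysis.

Set Implicit Arguments.
Unset Strict Implicit.
Unset Printing Implicit Defensive.
Import Order.TTheory GRing.Theory Num.Theory.
Import numFieldNormedType.Exports.

Local Open Scope classical_set_scope.
Local Open Scope ring_scope.

Definition atomless (disp : measure_display) (T : measurableType disp)
    (R : realType) (P : probability T R) : Prop :=
  forall A : set T, measurable A -> (0 < P A)%E ->
    exists B : set T,
      [/\ measurable B, B `<=` A, (0 < P B)%E & (P B < P A)%E].

Section spearman.
Context (disp : measure_display) (T : measurableType disp) (R : realType).
Variable P : probability T R.

(* The library's [cdf] takes values in [\bar R]; it always lies in [0, 1]. *)
Definition dist_fun (X : {RV P >-> R}) (r : R) : R := fine (cdf X r).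

Definition pearson (X Y : T -> R) : R :=
  fine (covariance P X Y)
    / (Num.sqrt (fine ('V_P[X])) * Num.sqrt (fine ('V_P[Y]))).

(* Meant for [X] and [Y] with continuous distribution functions. *)
Definition spearman_rho (X Y : {RV P >-> R}) : R :=
  pearson (dist_fun X \o X) (dist_fun Y \o Y).

(* A random vector is a family of random variables on the same space, i.e. a
   map measurable for the product sigma-algebra; its components may be
   arbitrarily dependent. *)
Definition spearman_matrix (d : nat) (X : 'I_d -> {RV P >-> R}) : 'M[R]_d :=
  \matrix_(i < d, j < d) spearman_rho (X i) (X j).

Definition spearman_matrices (d : nat) : set 'M[R]_d :=
  [set S | exists X : 'I_d -> {RV P >-> R},
     (forall i, continuous (dist_fun (X i))) /\ S = spearman_matrix X].

End spearman.
Arguments spearman_matrices [disp T R] P d _.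

Definition possemidef (R : realType) (d : nat) (A : 'M[R]_d) : Prop :=
  forall x : 'cV[R]_d, 0 <= (x^T *m A *m x) 0 0.

Definition correlation_matrices (R : realType) (d : nat) : set 'M[R]_d :=
  [set A | [/\ A^T = A, possemidef A & forall i, A i i = 1]].
Arguments correlation_matrices R d _ : clear implicits.

(* Main.v *)
(* The rank-4 Gram matrix of the unit vectors v_1, ..., v_12 along the 12 axes
   of the 24-cell is not a Spearman's rho matrix.  Let W_i = 1 - 2 F_i(X_i),
   which is uniform on [-1, 1], so that E W_i^2 = 1/3 and E W_i^4 = 1/5.  If
   3 E[W_i W_j] = <v_i, v_j> for all i, j, then almost surely
   W_i = <v_i, Z> with Z = (W_1, ..., W_4), because v_1, ..., v_4 is the
   standard basis.  The 24-cell is a spherical 5-design, whence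
   sum_i <v_i, Z>^4 = 3/2 |Z|^4 >= 4 |Z|^2 - 8/3; taking expectations gives
   12/5 >= 16/3 - 8/3, a contradiction. *)

Require Import Defs.
From HB Require Import structures.
From mathcomp Require Import all_boot all_order all_algebra.
From mathcomp Require Import all_classical all_reals all_analysis.
From mathcomp Require Import measurable_realfun ring lra.

Set Implicit Arguments.
Unset Strict Implicit.
Unset Printing Implicit Defensive.
Import Order.TTheory GRing.Theory Num.Theory.
Import numFieldNormedType.Exports.

Local Open Scope classical_set_scope.
Local Open Scope ring_scope.

(** * The 24-cell vectors and their identities *)

(* Row [i < 4] is a basis vector; row [i >= 4] is (+-1, +-1, +-1, +-1)/2, with the
   binary digits of [i - 4] as signs.  Rows 0 to 11 are the 24-cell up to sign;
   the later ones are still unit vectors, which pads the matrix to any [d]. *)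
Definition cell24 (R : realType) (i j : nat) : R :=
  if (i < 4)%N then (i == j)%:R else (-1) ^+ odd ((i - 4) %/ 2 ^ j) / 2.

(** Rows 4 to 11 all have last coordinate [1/2], so they pick one vector from each antipodal pair.
    The factor [3/2] can be read off at a basis vector: one axis contributes 1 and eight contribute
    [1/16] each. The proof is plain expansion. *)
Lemma cell24_quartic (R : realType) (z : 'I_4 -> R) :
  \sum_(k < 12) (\sum_(j < 4) cell24 R k j * z j) ^+ 4 =
  3 / 2 * (\sum_(j < 4) z j ^+ 2) ^+ 2.
Proof.
rewrite !big_ord_recl !big_ord0 /cell24 /=.
rewrite ?expr0 ?expr1 ?mul0r ?mul1r ?addr0 ?add0r.
by field.
Qed.

Lemma cell24_unit (R : realType) (i : nat) :
  \sum_(j < 4) cell24 R i j ^+ 2 = 1.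
Proof.
rewrite /cell24; case: ltnP => i4.
  by case: i i4 => [|[|[|[|]]]]// _; rewrite !big_ord_recl big_ord0 /=; ring.
under eq_bigr do rewrite expr_div_n sqrr_sign.
by rewrite sumr_const card_ord; field.
Qed.

Lemma cell24_low (R : realType) (i : 'I_4) (j : nat) :
  cell24 R i j = (i == j :> nat)%:R.
Proof. by rewrite /cell24 ltn_ord. Qed.

(** Row [j < 4] is a standard basis vector, so pairing with it reads off a coordinate. *)
Lemma cell24_dot_low (R : realType) (i : nat) (j : 'I_4) :
  \sum_(m < 4) cell24 R i m * cell24 R j m = cell24 R i j.
Proof.
rewrite (bigD1 j)//= big1 ?addr0; first by rewrite cell24_low eqxx mulr1.
by move=> m mj; rewrite cell24_low (negbTE (_ : j != m :> nat)) ?mulr0// eq_sym.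
Qed.

(** * The probability integral transform *)

Section uniform.
Context (disp : measure_display) (T : measurableType disp) (R : realType).
Variable P : probability T R.

Lemma dist_fun_ge0 (X : {RV P >-> R}) r : 0 <= dist_fun X r.
Proof. exact: fine_ge0. Qed.

Lemma dist_fun_le1 (X : {RV P >-> R}) r : dist_fun X r <= 1.
Proof. by rewrite -lee_fin fineK ?fin_num_measure// cdf_le1. Qed.

Lemma dist_fun_ndecr (X : {RV P >-> R}) : {homo dist_fun X : x y / x <= y}.
Proof. by move=> x y xy; rewrite fine_le ?fin_num_measure// cdf_nondecreasing. Qed.

Lemma measurable_dist_fun (X : {RV P >-> R}) : measurable_fun setT (dist_fun X).
Proof. by apply: nondecreasing_measurable => //= x y; exact: dist_fun_ndecr. Qed.

Lemma measurable_dist_fun_comp (X : {RV P >-> R}) :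
  measurable_fun setT (dist_fun X \o X).
Proof. by apply: measurableT_comp => //; exact: measurable_dist_fun. Qed.

(** Intermediate value theorem between the limits 0 and 1 at infinity. The levels 0 and 1 are left
    out, since they may not be attained. *)
Lemma dist_fun_surj (X : {RV P >-> R}) : continuous (dist_fun X) ->
  forall u, 0 < u < 1 -> exists a, dist_fun X a = u.
Proof.
move=> cF u /andP[u0 u1].
have [a Fa] : exists a, dist_fun X a < u.
  have /cvgr_lt : dist_fun X x @[x --> -oo] --> (0 : R).
    exact/fine_cvg/cvg_cdfNy0.
  by move=> /(_ _ u0) [M [_ /= H]]; exists (M - 1); apply: H; rewrite ltrBlDr ltrDl.
have [b Fb] : exists b, u < dist_fun X b.
  have /cvgr_gt : dist_fun X x @[x --> +oo] --> (1 : R).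
    exact/fine_cvg/cvg_cdfy1.
  by move=> /(_ _ u1) [M [_ /= H]]; exists (M + 1); apply: H; rewrite ltrDl.
have ab : a <= b.
  by rewrite leNgt; apply/negP => /ltW /(dist_fun_ndecr X); rewrite leNgt (lt_trans Fa).
have [||c _ <-] := @IVT _ (dist_fun X) a b u ab; last by exists c.
- by apply: continuous_subspaceT.
- by rewrite ge_min le_max (ltW Fa) (ltW Fb) orbT.
Qed.

Lemma prob_dist_fun_le (X : {RV P >-> R}) : continuous (dist_fun X) ->
  forall u, 0 <= u < 1 -> P [set t | dist_fun X (X t) <= u] = u%:E.
Proof.
move=> cF u /andP[u0 u1].
have mS : measurable [set t | dist_fun X (X t) <= u].
  rewrite -[X in measurable X]setTI.
  have := measurable_dist_fun_comp X; move/(_ measurableT `]-oo, u]%classic).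
  have -> : (dist_fun X \o X) @^-1` `]-oo, u] = [set t | dist_fun X (X t) <= u].
    by apply/seteqP; split => t /=; rewrite in_itv.
  by apply.
have PXE a : P [set t | X t <= a] = (dist_fun X a)%:E.
  by rewrite fineK ?fin_num_measure.
have mX a : measurable [set t | X t <= a].
  rewrite (_ : [set t | X t <= a] = X @^-1` `]-oo, a]).
    exact: measurable_funPTI.
  by apply/seteqP; split => t /=; rewrite in_itv.
apply/le_anti/andP; split.
(* The distribution function may be flat beyond a point of level [u], so the upper bound compares
   with a point of level [u + e]. *)
- apply/lee_addgt0Pr => e e0.
  have [ue|ue] := leP 1 (u + e).
    apply: (le_trans (probability_le1 P mS)).
    by rewrite -EFinD lee_fin.
  have [|b Fb] := dist_fun_surj cF (u := u + e).
    by rewrite ue andbT ltr_wpDl.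
  rewrite -EFinD -Fb -PXE; apply: le_measure; rewrite ?inE//.
  move=> t /= FX; rewrite leNgt; apply/negP => /ltW /(dist_fun_ndecr X).
  by rewrite Fb leNgt (le_lt_trans FX)// ltrDl.
(* At [u = 0] the bound is nonnegativity of [P]; no point of level 0 need exist. *)
- move: u0; rewrite [0 <= u]le_eqVlt => /predU1P[<-//|u0].
  have [|a Fa] := dist_fun_surj cF (u := u); first by rewrite u0.
  rewrite -[in leLHS]Fa -PXE; apply: le_measure; rewrite ?inE//.
  by move=> t /= /(dist_fun_ndecr X); rewrite Fa.
Qed.

End uniform.

(** * Moments of ranks and the covariance formula for Spearman's rho *)

Section moments.
Context (disp : measure_display) (T : measurableType disp) (R : realType).
Variable P : probability T R.

(** A class closed under sums and products and contained in the integrable functions, so that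
    linearity of the mean applies to every polynomial in the ranks. *)
Definition bounded_measurable (f : T -> R) :=
  measurable_fun setT f /\ exists M, forall t, `|f t| <= M.

Lemma bounded_measurable_cst c : bounded_measurable (fun=> c).
Proof. by split => //; exists `|c|. Qed.

Lemma bounded_measurableD f g : bounded_measurable f -> bounded_measurable g ->
  bounded_measurable (fun t => f t + g t).
Proof.
move=> [mf [M fM]] [mg [N gN]]; split; first exact: measurable_funD.
by exists (M + N) => t; rewrite (le_trans (ler_normD _ _))// lerD.
Qed.

Lemma bounded_measurableM f g : bounded_measurable f -> bounded_measurable g ->
  bounded_measurable (fun t => f t * g t).
Proof.
move=> [mf [M fM]] [mg [N gN]]; split; first exact: measurable_funM.
by exists (M * N) => t; rewrite normrM ler_pM.
Qed.

Lemma bounded_measurableX f n : bounded_measurable f ->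
  bounded_measurable (fun t => f t ^+ n).
Proof.
move=> bf; elim: n => [|n IH]; first exact: bounded_measurable_cst.
by under eq_fun do rewrite exprS; exact: bounded_measurableM.
Qed.

Lemma bounded_measurable_sum (I : Type) (s : seq I) (f : I -> T -> R) :
  (forall i, bounded_measurable (f i)) ->
  bounded_measurable (fun t => \sum_(i <- s) f i t).
Proof.
move=> bf; elim: s => [|i s IH].
  by under eq_fun do rewrite big_nil; exact: bounded_measurable_cst.
by under eq_fun do rewrite big_cons; exact: bounded_measurableD.
Qed.

Lemma bounded_measurable_integrable f : bounded_measurable f ->
  P.-integrable setT (EFin \o f).
Proof.
move=> [mf [M fM]]; apply: measurable_bounded_integrable => //.
  by rewrite (le_lt_trans (probability_le1 _ _))// ltry.
exists M; split; first exact: num_real.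
by move=> N MN t _; exact: le_trans (fM t) (ltW MN).
Qed.

Lemma mean_cst (c : R) : \int[P]_t c = c.
Proof. by rewrite Rintegral_cst//= probability_setT mulr1. Qed.

Lemma meanD f g : bounded_measurable f -> bounded_measurable g ->
  \int[P]_t (f t + g t) = \int[P]_t f t + \int[P]_t g t.
Proof. by move=> bf bg; rewrite RintegralD//; exact: bounded_measurable_integrable. Qed.

Lemma meanZ c f : bounded_measurable f ->
  \int[P]_t (c * f t) = c * \int[P]_t f t.
Proof. by move=> bf; rewrite RintegralZl//; exact: bounded_measurable_integrable. Qed.

Lemma mean_sum (I : Type) (s : seq I) (f : I -> T -> R) :
  (forall i, bounded_measurable (f i)) ->
  \int[P]_t (\sum_(i <- s) f i t) = \sum_(i <- s) \int[P]_t f i t.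
Proof.
move=> bf; elim: s => [|i s IH].
  by under eq_Rintegral do rewrite big_nil; rewrite mean_cst big_nil.
under eq_Rintegral do rewrite big_cons.
by rewrite big_cons meanD ?IH//; exact: bounded_measurable_sum.
Qed.

(** The law of [dist_fun X \o X] is uniform on [[0, 1]]: the two measures agree on the rays []x,
    +oo[], a generating family closed under intersection. Change of variables then gives the
    formula. *)
Lemma integral_dist_fun (X : {RV P >-> R}) (f : R -> \bar R) :
  continuous (dist_fun X) -> measurable_fun setT f -> (forall x, 0 <= f x)%E ->
  (\int[P]_t f (dist_fun X (X t)) = \int[lebesgue_measure]_(x in `[0%R, 1%R]) f x)%E.
Proof.
move=> cF mf f0.
(* [lebesgue_measure] lives on [measurableTypeR R], whose display differs from
   that of [R]; hence the detour through a second view of the same map. *)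
pose V : T -> measurableTypeR R := dist_fun X \o X.
have mV : measurable_fun setT V by exact: measurable_dist_fun_comp.
pose mfunV : {mfun T >-> measurableTypeR R} :=
  HB.pack V (isMeasurableFun.Build _ _ _ _ V mV).
suff uniV A : measurable A -> pushforward P mfunV A = uniform_prob (@ltr01 R) A.
  transitivity (\int[pushforward P mfunV]_x f x)%E.
    by rewrite ge0_integral_pushforward.
  rewrite (eq_measure_integral (uniform_prob (@ltr01 R))); last first.
    by move=> A mA _; exact: uniV.
  by rewrite integral_uniform// subr0 invr1 mul1e.
move=> mA.
pose G : set (set R) := [set A | exists x, A = `]x, +oo[%classic].
apply: (@measure_unique _ R (measurableTypeR R) G
  (fun k : nat => `](- k%:R)%R, +oo[%classic)) mA => //=.
- exact: RGenOInfty.measurableE.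
- move=> _ _ [x ->] [y ->]; exists (Num.max x y).
  by apply/seteqP; split => z /=; rewrite !in_itv/= !andbT gt_max => /andP.
- by move=> k; exists (- k%:R).
- apply/seteqP; split => // x _; exists (Num.truncn `|x|).+1 => //=.
  rewrite in_itv/= andbT ltrNl (le_lt_trans _ (truncnS_gt _))//.
  by rewrite -normrN ler_norm.
- move=> _ [x ->].
  rewrite /uniform_prob integral_uniform_pdf.
  rewrite (eq_integral (fun=> 1%E)); last first.
    move=> y; rewrite inE/= => -[_]; rewrite in_itv /= /uniform_pdf => ->.
    by rewrite subr0 invr1.
  rewrite integral_cst/=; last exact: measurableI.
  rewrite mul1e /pushforward.
  have -> : V @^-1` `]x, +oo[ = ~` [set t | dist_fun X (X t) <= x].
    apply/seteqP; split => t /=; rewrite in_itv/= andbT ltNge; first by move/negP.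
    by move=> /negP.
  have [x0|x0] := ltP x 0.
    have -> : [set t | dist_fun X (X t) <= x] = set0.
      apply/seteqP; split => // t /=.
      by rewrite leNgt (lt_le_trans x0)// dist_fun_ge0.
    rewrite setC0 probability_setT.
    have -> : `]x, +oo[ `&` `[0, 1] = `[0, 1]%classic.
      rewrite setIidr// => y /=; rewrite !in_itv/= andbT => /andP[y0 _].
      exact: lt_le_trans y0.
    by rewrite lebesgue_measure_itv/= lte_fin ltr01 sube0.
  have [x1|x1] := leP 1 x.
    have -> : [set t | dist_fun X (X t) <= x] = setT.
      by apply/seteqP; split => // t _ /=; rewrite (le_trans _ x1)// dist_fun_le1.
    have -> : `]x, +oo[ `&` `[0, 1] = set0.
      apply/seteqP; split => // y /= []; rewrite !in_itv/= andbT => xy /andP[_ y1].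
      by move: (lt_le_trans xy y1); rewrite ltNge x1.
    by rewrite setCT !measure0.
  rewrite probability_setC; last first.
    rewrite -[X in measurable X]setTI.
    have -> : [set t | dist_fun X (X t) <= x] = (dist_fun X \o X) @^-1` `]-oo, x].
      by apply/seteqP; split => t /=; rewrite in_itv.
    exact: measurable_dist_fun_comp.
  rewrite prob_dist_fun_le ?x0//.
  have -> : `]x, +oo[ `&` `[0, 1] = `]x, 1]%classic.
    apply/seteqP; split => y /=; rewrite !in_itv/= andbT.
      by move=> [-> /andP[_ ->]].
    by move=> /andP[xy ->]; rewrite xy (le_trans x0 (ltW xy)).
  by rewrite lebesgue_measure_itv/= lte_fin x1.
- move=> k; apply: (le_lt_trans (probability_le1 P _)); last exact: ltry.
  by rewrite -[X in measurable X]setTI; exact: (measurable_dist_fun_comp X).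
Qed.

Lemma mean_onem_dist_fun (X : {RV P >-> R}) n : continuous (dist_fun X) ->
  \int[P]_t (1 - dist_fun X (X t)) ^+ n = n.+1%:R^-1.
Proof.
move=> cF; rewrite -Rintegral_onemXn /Rintegral; congr fine.
(* The absolute value makes the integrand nonnegative on the whole line, as [integral_dist_fun]
   demands, and changes nothing on [[0, 1]]. *)
transitivity (\int[P]_t (`|1 - dist_fun X (X t)| ^+ n)%:E)%E.
  by apply: eq_integral => t _; rewrite ger0_norm// subr_ge0 dist_fun_le1.
rewrite (integral_dist_fun (f := fun x => (`|1 - x| ^+ n)%:E))//.
- apply: eq_integral => x.
  by rewrite inE/= in_itv/= => /andP[_ x1]; rewrite ger0_norm// subr_ge0.
- apply/measurable_EFinP; apply: measurable_funX; apply: measurableT_comp => //.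
  exact: measurable_funB.
Qed.

Definition centered_rank (X : {RV P >-> R}) (t : T) : R :=
  1 - 2 * dist_fun X (X t).

Lemma bounded_measurable_onem_dist_fun (X : {RV P >-> R}) :
  bounded_measurable (fun t => 1 - dist_fun X (X t)).
Proof.
split; first by apply: measurable_funB => //; exact: measurable_dist_fun_comp.
exists 1 => t; rewrite ger0_norm ?subr_ge0 ?dist_fun_le1//.
by rewrite lerBlDr lerDl dist_fun_ge0.
Qed.

Lemma bounded_measurable_centered_rank (X : {RV P >-> R}) :
  bounded_measurable (centered_rank X).
Proof.
split.
  apply: measurable_funB => //; apply: measurable_funM => //.
  exact: measurable_dist_fun_comp.
exists 1 => t; rewrite ler_norml /centered_rank.
by have := dist_fun_ge0 X (X t); have := dist_fun_le1 X (X t); lra.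
Qed.

Lemma mean_centered_rank2 (X : {RV P >-> R}) : continuous (dist_fun X) ->
  \int[P]_t centered_rank X t ^+ 2 = 3^-1.
Proof.
(* With [u = 1 - dist_fun X (X t)] the centered rank is [2 * u - 1]. The exponent 1 is kept so that
   [mean_onem_dist_fun] rewrites every power. *)
move=> cF; transitivity (\int[P]_t (4 * (1 - dist_fun X (X t)) ^+ 2
    + ((- 4) * (1 - dist_fun X (X t)) ^+ 1 + 1))).
  by apply: eq_Rintegral => t _; rewrite /centered_rank; ring.
have bX n := bounded_measurableX n (bounded_measurable_onem_dist_fun X).
have bc c := bounded_measurable_cst c.
have bcX c n := bounded_measurableM (bc c) (bX n).
by rewrite !meanD ?meanZ ?mean_onem_dist_fun ?mean_cst//;
  [field|exact: bounded_measurableD].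
Qed.

Lemma mean_centered_rank4 (X : {RV P >-> R}) : continuous (dist_fun X) ->
  \int[P]_t centered_rank X t ^+ 4 = 5^-1.
Proof.
move=> cF; transitivity (\int[P]_t (16 * (1 - dist_fun X (X t)) ^+ 4
    + ((- 32) * (1 - dist_fun X (X t)) ^+ 3
    + (24 * (1 - dist_fun X (X t)) ^+ 2
    + ((- 8) * (1 - dist_fun X (X t)) ^+ 1 + 1))))).
  by apply: eq_Rintegral => t _; rewrite /centered_rank; ring.
have bX n := bounded_measurableX n (bounded_measurable_onem_dist_fun X).
have bc c := bounded_measurable_cst c.
have bcX c n := bounded_measurableM (bc c) (bX n).
rewrite !meanD ?meanZ ?mean_onem_dist_fun ?mean_cst//; first by field.
all: by do ?[exact: bcX|exact: bc|apply: bounded_measurableD].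
Qed.

(** Each [dist_fun] has mean [1/2], and its deviation from the mean is minus half the centered rank;
    the two signs cancel. *)
Lemma covariance_dist_fun (X Y : {RV P >-> R}) :
  continuous (dist_fun X) -> continuous (dist_fun Y) ->
  fine (covariance P (dist_fun X \o X) (dist_fun Y \o Y)) =
  (\int[P]_t (centered_rank X t * centered_rank Y t)) / 4.
Proof.
move=> cX cY.
have EU (Z : {RV P >-> R}) : continuous (dist_fun Z) -> fine ('E_P[dist_fun Z \o Z]) = 2^-1.
  move=> cZ; rewrite unlock.
  transitivity (\int[P]_t ((-1) * (1 - dist_fun Z (Z t)) ^+ 1 + 1)).
    by apply: eq_Rintegral => t _ /=; ring.
  have bX := bounded_measurableX 1 (bounded_measurable_onem_dist_fun Z).
  have bc c := bounded_measurable_cst c.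
  rewrite meanD ?meanZ ?mean_onem_dist_fun ?mean_cst//; first by field.
  exact: bounded_measurableM.
rewrite unlock !EU// unlock.
rewrite [RHS]mulrC -meanZ; last first.
  by apply: bounded_measurableM; exact: bounded_measurable_centered_rank.
by apply: eq_Rintegral => t _; rewrite /centered_rank /= !fctE/=; field.
Qed.

(** Both variances are [1/12], and [(1/4) / (1/12) = 3]. *)
Lemma spearman_rhoE (X Y : {RV P >-> R}) :
  continuous (dist_fun X) -> continuous (dist_fun Y) ->
  spearman_rho X Y = 3 * \int[P]_t (centered_rank X t * centered_rank Y t).
Proof.
move=> cX cY; rewrite /spearman_rho /pearson /variance !covariance_dist_fun//.
have V (Z : {RV P >-> R}) : continuous (dist_fun Z) ->
    \int[P]_t (centered_rank Z t * centered_rank Z t) = 3^-1.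
  by move=> cZ; exact: mean_centered_rank2.
rewrite !V// -expr2 sqr_sqrtr; first by field.
by rewrite divr_ge0 ?invr_ge0.
Qed.

End moments.

(** * Twelve ranks with the 24-cell Gram matrix are contradictory *)

Section cell24_ranks.
Context (disp : measure_display) (T : measurableType disp) (R : realType).
Variables (P : probability T R) (X : 'I_12 -> {RV P >-> R}).
Hypothesis cX : forall i, continuous (dist_fun (X i)).
Hypothesis rhoX : forall i j : 'I_12, spearman_rho (X i) (X j) =
  \sum_(m < 4) cell24 R i m * cell24 R j m.

Let W i := centered_rank (X i).
Let low (j : 'I_4) : 'I_12 := widen_ord (isT : (4 <= 12)%N) j.
(** This is [<v_k, Z>], where [Z] consists of the first four centered ranks. *)
Let L (k : 'I_12) t : R := \sum_(j < 4) cell24 R k j * W (low j) t.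

Let bW i : bounded_measurable (W i).
Proof. exact: bounded_measurable_centered_rank. Qed.

Let bWW i j : bounded_measurable (fun t => W i t * W j t).
Proof. exact: bounded_measurableM. Qed.

Let bZ c f : bounded_measurable f -> bounded_measurable (fun t : T => c * f t : R).
Proof. by apply: bounded_measurableM; exact: bounded_measurable_cst. Qed.

Let meanWW i j : \int[P]_t (W i t * W j t) =
  (\sum_(m < 4) cell24 R i m * cell24 R j m) / 3.
Proof. by rewrite -rhoX spearman_rhoE// mulrC mulrA mulVf// mul1r. Qed.

(** Expanding the square gives [(|v_k|^2 - 2 |v_k|^2 + |v_k|^2) / 3]. *)
Lemma mean_rank_defect k : \int[P]_t (W k t - L k t) ^+ 2 = 0.
Proof.
transitivity (\int[P]_t (W k t * W k t +
   ((- 2) * (\sum_(j < 4) cell24 R k j * (W k t * W (low j) t)) +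
   \sum_(j < 4) \sum_(l < 4)
     cell24 R k j * cell24 R k l * (W (low j) t * W (low l) t)))).
  apply: eq_Rintegral => t _.
  rewrite sqrrB [in RHS]addrA expr2; congr (_ + _ + _).
    rewrite -mulr_natl mulNr; congr (- (_ * _)); rewrite mulr_sumr.
    by apply: eq_bigr => j _; rewrite mulrCA.
  rewrite expr2 /L mulr_suml; apply: eq_bigr => j _; rewrite mulr_sumr.
  by apply: eq_bigr => l _; rewrite mulrACA.
have b1 : bounded_measurable
    (fun t => \sum_(j < 4) cell24 R k j * (W k t * W (low j) t)).
  by apply: bounded_measurable_sum => j; exact: bZ.
have b2 (j : 'I_4) : bounded_measurable (fun t => \sum_(l < 4)
    cell24 R k j * cell24 R k l * (W (low j) t * W (low l) t)).
  by apply: bounded_measurable_sum => l; exact: bZ.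
have b3 := bounded_measurable_sum (index_enum 'I_4) b2.
rewrite !meanD ?meanZ ?mean_sum//; last 3 first.
- by move=> j; exact: bZ.
- exact: bZ.
- by apply: bounded_measurableD => //; exact: bZ.
under [in X in _ + (_ * X + _)]eq_bigr do
  rewrite meanZ// meanWW cell24_dot_low mulrA -expr2.
under [X in _ + (_ + X)]eq_bigr => j _.
  rewrite mean_sum; last by move=> l; exact: bZ.
  under eq_bigr do rewrite meanZ// meanWW cell24_dot_low.
  (* The first four ranks are pairwise uncorrelated, so only [l = j] survives. *)
  rewrite (bigD1 j)//= big1 ?addr0; last first.
    move=> l lj; rewrite cell24_low (negbTE (_ : j != l :> nat)) ?mul0r ?mulr0//.
    by rewrite eq_sym.
  rewrite cell24_low eqxx mul1r -expr2.
  over.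
rewrite -!mulr_suml cell24_unit meanWW.
under eq_bigr do rewrite -expr2.
by rewrite cell24_unit; field.
Qed.

(** A nonnegative function with zero mean vanishes almost everywhere; as [k] ranges over a finite
    type, one null set serves all [k]. *)
Lemma ae_rank_eq : {ae P, forall t, forall k, W k t = L k t}.
Proof.
apply: filter_forall => k.
pose D t := (W k t - L k t) ^+ 2.
have bD : bounded_measurable D.
  apply/bounded_measurableX/bounded_measurableD => //.
  under eq_fun do rewrite -mulN1r; apply: bZ.
  by apply: bounded_measurable_sum => j; exact: bZ.
have mD : measurable_fun setT (EFin \o D) by apply/measurable_EFinP; case: bD.
have /(ae_eq_integral_abs P measurableT mD) : (\int[P]_t `|(D t)%:E| = 0)%E.
  under eq_integral do rewrite gee0_abs ?lee_fin ?sqr_ge0//.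
  (* [fine] sends infinities to 0, so finiteness is needed before the vanishing real integral can be
     used. *)
  rewrite -[LHS]fineK; last first.
    exact: integrable_fin_num (bounded_measurable_integrable P bD).
  by have /= := mean_rank_defect k; rewrite /Rintegral => ->.
apply: filterS => t /(_ I) /= [] /eqP.
by rewrite sqrf_eq0 subr_eq0 => /eqP.
Qed.

Lemma cell24_ranks_absurd : False.
Proof.
have bl : bounded_measurable (fun t => 4 * \sum_(j < 4) W (low j) t ^+ 2).
  by apply: bZ; apply: bounded_measurable_sum => j; exact: bounded_measurableX.
have b4 : bounded_measurable (fun t => \sum_(k < 12) W k t ^+ 4).
  by apply: bounded_measurable_sum => j; exact: bounded_measurableX.
have br : bounded_measurable (fun t => \sum_(k < 12) W k t ^+ 4 + 8 / 3).
  by apply: bounded_measurableD => //; exact: bounded_measurable_cst.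
(* The constant [8/3] stands on the right so that both integrands are nonnegative, as
   [ae_ge0_le_integral] requires. *)
have : 4 * (\sum_(j < 4) 3^-1) <= \sum_(k < 12) 5^-1 + 8 / 3 :> R.
  have <- : \int[P]_t (4 * \sum_(j < 4) W (low j) t ^+ 2) = 4 * \sum_(j < 4) 3^-1.
    rewrite meanZ; last first.
      by apply: bounded_measurable_sum => j; exact: bounded_measurableX.
    rewrite mean_sum; last by move=> j; exact: bounded_measurableX.
    by congr (_ * _); apply: eq_bigr => j _; exact: mean_centered_rank2.
  have <- : \int[P]_t (\sum_(k < 12) W k t ^+ 4 + 8 / 3) = \sum_(k < 12) 5^-1 + 8 / 3.
    rewrite meanD ?mean_cst//; last exact: bounded_measurable_cst.
    rewrite mean_sum; last by move=> j; exact: bounded_measurableX.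
    by congr (_ + _); apply: eq_bigr => j _; exact: mean_centered_rank4.
  rewrite /Rintegral fine_le//.
  - exact: integrable_fin_num (bounded_measurable_integrable P bl).
  - exact: integrable_fin_num (bounded_measurable_integrable P br).
  apply: ae_ge0_le_integral => //.
  - by move=> t _; rewrite lee_fin mulr_ge0// sumr_ge0// => j _; exact: sqr_ge0.
  - by apply/measurable_EFinP; case: bl.
  - move=> t _; rewrite lee_fin addr_ge0 ?divr_ge0//.
    by rewrite sumr_ge0// => j _; exact: exprn_even_ge0.
  - by apply/measurable_EFinP; case: br.
  apply: filterS ae_rank_eq => t WL _; rewrite lee_fin.
  have -> : \sum_(k < 12) W k t ^+ 4 = \sum_(k < 12) L k t ^+ 4.
    by apply: eq_bigr => k _; congr (_ ^+ _); exact: WL.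
  rewrite cell24_quartic; set q := \sum_(_ < _) _.
  (* The line [4 q - 8/3] is tangent to [3/2 q^2] at [q = 4/3], the mean of [|Z|^2]: this is
     Jensen's inequality made explicit. *)
  rewrite -subr_ge0 [leRHS](_ : _ = 3 / 2 * (q - 4 / 3) ^+ 2); last by field.
  by rewrite mulr_ge0 ?sqr_ge0 ?divr_ge0.
rewrite !sumr_const !card_ord; lra.
Qed.

End cell24_ranks.

(** * The Gram matrix in dimension [d] and the conclusion *)

Definition cell24_mx (R : realType) (d : nat) : 'M[R]_(d, 4) :=
  \matrix_(i < d, j < 4) cell24 R i j.

Lemma cell24_gramE (R : realType) (d : nat) (i j : 'I_d) :
  (cell24_mx R d *m (cell24_mx R d)^T) i j =
  \sum_(m < 4) cell24 R i m * cell24 R j m.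
Proof. by rewrite mxE; apply: eq_bigr => m _; rewrite !mxE. Qed.

Lemma correlation_cell24_gram (R : realType) (d : nat) :
  correlation_matrices R d (cell24_mx R d *m (cell24_mx R d)^T).
Proof.
split.
- by rewrite trmx_mul trmxK.
- move=> x; set M := cell24_mx R d.
  have -> : x^T *m (M *m M^T) *m x = (M^T *m x)^T *m (M^T *m x).
    by rewrite trmx_mul trmxK !mulmxA.
  by rewrite mxE sumr_ge0// => i _; rewrite mxE -expr2 sqr_ge0.
- move=> i; rewrite cell24_gramE -[RHS](cell24_unit R i).
  by apply: eq_bigr => m _; rewrite expr2.
Qed.

Theorem proposition3p1 (R : realType) (disp : measure_display)
    (T : measurableType disp) (P : probability T R) (hP : atomless P)
    (d : nat) (hd : (12 <= d)%N) :
  spearman_matrices P d <> correlation_matrices R d.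
Proof.
move=> SP; have := correlation_cell24_gram R d; rewrite -SP => -[X [cX gramX]].
(* The first twelve components of a vector realizing the [d]-dimensional Gram matrix realize that of
   the 24-cell axes. *)
apply: (@cell24_ranks_absurd _ _ _ P (fun i => X (widen_ord hd i))) => // i j.
by rewrite -(cell24_gramE R (widen_ord hd i) (widen_ord hd j)) gramX mxE.
Qed.
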